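(* Let $f(X)=a_{0}+a_{1}X+\cdots +a_{n}X^{n}\in \mathbb{Z}[X]$, $a_{0}a_{n}\neq 0$. Suppose there exist two distinct prime numbers $p$ and $q$ such that (i) $\nu _{p}(a_{0})>0$, $\frac{\nu _{p}(a_{i})}{n-1-i}>\frac{\nu _{p}(a_{0})}{n-1}$ for $0<i<n-1$, and $\nu _{p}(a_{n-1})=0$; (ii) $\nu _{q}(a_{0})=0$, $\frac{\nu _{q}(a_{i})}{i}\geq\frac{\nu _{q}(a_{n})}{n}$ for all $1\le i\le n$, and $n\nmid \nu _{q}(a_{n})$; (iii) $\gcd(\nu _{p}(a_{0}),n-1)=1$. Then $f$ is irreducible over $\mathbb{Q}$.
   Context: For a prime $p$ and a nonzero integer $m$, $\nu_p(m)$ is the largest integer $i$ such that $p^i\mid m$; by convention $\nu_p(0)=\infty$ (so lower bounds on $\nu_p(a_i)$ hold automatically when $a_i=0$). *)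

(* Defs.v *)
From mathcomp Require Import all_boot all_order all_algebra.
From mathcomp Require Import constructive_ereal.

Set Implicit Arguments.
Unset Strict Implicit.
Unset Printing Implicit Defensive.

Import Order.TTheory GRing.Theory Num.Theory.

Local Open Scope ring_scope.

(* The p-adic valuation with nu p 0 = +oo. The test m == 0 is needed because
   logn p 0 = 0. Values lie in the extended rationals so that quotients by
   positive naturals make sense, with +oo / r = +oo for r > 0. *)
Definition nu (p : nat) (m : int) : \bar rat :=
  if m == 0 then +oo%E else (logn p `|m|%N)%:R%:E.

(* Main.v *)
(* Dumas' argument.  In a factorization f = g h, the endpoints of the faces of a
   given slope of the Newton polygons of g and h add up to those of f.  At p,
   the polygon of f has a face from 0 to n - 1 without interior lattice points,
   so one factor has degree at least n - 1.  If f were reducible, the other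
   factor would be linear; but at q the polygon of f is a single face of
   non-integral slope, which leaves no room for a linear factor. *)
Require Import Defs.
From mathcomp Require Import all_boot all_order all_algebra.
From mathcomp Require Import constructive_ereal.
From mathcomp Require Import zify.

Set Implicit Arguments.
Unset Strict Implicit.
Unset Printing Implicit Defensive.

Import Order.TTheory GRing.Theory Num.Theory.

Local Open Scope ring_scope.

(** * Valuations of nonzero integers; [vz p 0] has the default value 0 *)

Local Notation vz p m := (logn p (absz m)).

Lemma dvdz_pfactor (p k : nat) (m : int) : prime p -> m != 0 ->
  ((p ^ k)%N%:Z %| m)%Z = (k <= vz p m)%N.
Proof. by move=> pp m0; rewrite dvdzE /= pfactor_dvdn ?absz_gt0. Qed.

Lemma vzM (p : nat) (x y : int) : x != 0 -> y != 0 ->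
  vz p (x * y) = (vz p x + vz p y)%N.
Proof. by move=> x0 y0; rewrite abszM lognM ?absz_gt0. Qed.

(** Ultrametric inequality: otherwise [p ^ (vz p S).+1] would divide every term, hence the sum
    [S]. *)
Lemma vz_sum_ge (p : nat) (I : finType) (P : pred I) (F : I -> int) :
    prime p -> \sum_(i | P i) F i != 0 ->
  exists i, [/\ P i, F i != 0 & (vz p (F i) <= vz p (\sum_(i | P i) F i)%R)%N].
Proof.
move=> pp S0; set S := \sum_(i | P i) F i in S0 *.
have [/existsP[i /and3P[]]|] :=
    boolP [exists i, [&& P i, F i != 0 & (vz p (F i) <= vz p S)%N]].
  by exists i.
rewrite negb_exists => /forallP noF.
suff: ((p ^ (vz p S).+1)%N%:Z %| S)%Z by rewrite dvdz_pfactor // ltnn.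
apply: rpred_sum => i Pi; have := noF i.
rewrite Pi /=; case: eqVneq => [-> _|Fi0 /=]; first exact: dvdz0.
by rewrite -ltnNge -dvdz_pfactor.
Qed.

(** * Faces of Newton polygons and their behaviour under products *)

(** A linear form on the points [(i, vz p g_i)] of the Newton diagram, minimal along the face of
    slope [- B / A]; the denominator [A] is cleared to stay in [int]. It is meaningful only where
    the coefficient is nonzero. *)
Definition newton_weight (p A : nat) (B : int) (g : {poly int}) (i : nat) : int :=
  (A * vz p (g`_i)%R)%N%:Z + B * i%:Z.

(* With [e = 1] (resp. [e = -1]) this is the left (resp. right) endpoint of the
   face of the [p]-Newton polygon of [g] of slope [- B / A]: the indices of
   minimal weight are ordered by [e * i], so that the minimum is strict. *)
Definition newton_vertex (p A : nat) (B e : int) (g : {poly int}) (i : nat) :=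
  g`_i != 0 /\ forall j, g`_j != 0 -> j != i ->
  newton_weight p A B g i < newton_weight p A B g j \/
  newton_weight p A B g i = newton_weight p A B g j /\ e * i%:Z < e * j%:Z.

Lemma newton_vertex_uniq p A B e g i j :
  newton_vertex p A B e g i -> newton_vertex p A B e g j -> i = j.
Proof.
move=> [gi gmin] [gj gmin']; apply/eqP; apply: contraT => ij.
have ji : j != i by rewrite eq_sym.
by have := gmin _ gj ji; have := gmin' _ gi ij; lia.
Qed.

Lemma newton_vertex_ex p A B (e : int) (g : {poly int}) : e != 0 -> g != 0 ->
  exists i, newton_vertex p A B e g i.
Proof.
move=> e0 g0.
have i0P : ((size g).-1 < size g)%N by rewrite ltn_predL size_poly_gt0.
(* Lexicographic minimum; [e != 0] makes the second component injective, so ties are impossible. *)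
pose key (i : 'I_(size g)) : int *l int :=
  (newton_weight p A B g i, e * i%:Z).
pose P := [pred i : 'I_(size g) | g`_i != 0].
have Pi0 : P (Ordinal i0P) by rewrite /= -lead_coefE lead_coef_eq0.
case: (arg_minP key Pi0) => i /= gi imin.
exists i; split=> // j gj ji.
have jlt : (j < size g)%N by rewrite ltnNge; apply: contra gj => /leq_sizeP ->.
have := imin (Ordinal jlt) gj; rewrite leEprodlexi /= => /andP[le1 le2].
have [lt1|] := ltP (newton_weight p A B g i) (newton_weight p A B g j).
  by left.
move=> ge1; rewrite ge1 /= in le2; right.
split; first by apply/eqP; rewrite eq_le le1.
by rewrite lt_neqAle le2 andbT; apply: contra ji => /eqP /(mulfI e0) [->].
Qed.

(** Among the terms of the coefficient of index [i + j], the product of the two vertex coefficients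
    alone has minimal valuation, so it cannot cancel. *)
Lemma newton_vertexM p A B (e : int) (g h : {poly int}) i j : prime p -> (0 < A)%N ->
    newton_vertex p A B e g i -> newton_vertex p A B e h j ->
  newton_vertex p A B e (g * h) (i + j) /\
  newton_weight p A B (g * h) (i + j) =
    newton_weight p A B g i + newton_weight p A B h j.
Proof.
move=> pp A0 [gi gmin] [hj hmin].
pose w := newton_weight p A B.
have termw k l : g`_k != 0 -> h`_l != 0 ->
    (A * vz p (g`_k * h`_l)%R)%N%:Z + B * (k + l)%N%:Z = w g k + w h l.
  by move=> gk hl; rewrite vzM // /w /newton_weight; lia.
(* The lexicographic order on (weight, [e] times index) is compatible with addition, so [(i, j)] is
   the strict minimum over pairs. *)
have termge k l : g`_k != 0 -> h`_l != 0 -> (k != i) || (l != j) ->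
    w g i + w h j < w g k + w h l \/
    w g i + w h j = w g k + w h l /\ e * (i + j)%N%:Z < e * (k + l)%N%:Z.
  move=> gk hl; rewrite !PoszD !mulrDr.
  case: (eqVneq k i) => [->|ki] /=; [|case: (eqVneq l j) => [->|lj] /= _].
  - by move=> lj; have := hmin _ hl lj; rewrite -/w; lia.
  - by have := gmin _ gk ki; rewrite -/w; lia.
  - by have := gmin _ gk ki; have := hmin _ hl lj; rewrite -/w; lia.
have coefge l : (g * h)`_l != 0 -> exists k, [/\ (k <= l)%N, g`_k != 0,
    h`_(l - k)%N != 0 & w g k + w h (l - k)%N <= w (g * h) l].
  rewrite coefM => S0; have [k [_]] := vz_sum_ge pp S0.
  rewrite mulf_eq0 negb_or => /andP[gk hk] le_v; exists k.
  have kl : (k <= l)%N by rewrite -ltnS.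
  split=> //; rewrite -termw // subnKC // /w /newton_weight coefM.
  by rewrite lerD2r lez_nat leq_mul2l le_v orbT.
have iij : (i < (i + j).+1)%N by rewrite ltnS leq_addr.
set T := g`_i * h`_j.
have T0 : T != 0 by rewrite mulf_neq0.
(* Within one coefficient the indices have the same sum, so the tie-break is void: the other terms
   have strictly larger weight, hence valuation. *)
have [R eqR Rdvd] : exists2 R, (g * h)`_(i + j) = T + R &
    ((p ^ (vz p T).+1)%N%:Z %| R)%Z.
  exists (\sum_(k < (i + j).+1 | k != Ordinal iij) g`_k * h`_(i + j - k)%N).
    by rewrite coefM (bigD1 (Ordinal iij)) //= addKn.
  apply: rpred_sum => k; rewrite -val_eqE /= => ki.
  have [->|] := eqVneq (g`_k * h`_(i + j - k)%N) 0; first exact: dvdz0.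
  move=> F0; rewrite dvdz_pfactor //; move: F0.
  rewrite mulf_eq0 negb_or => /andP[gk hk].
  have kl : (k <= i + j)%N by rewrite -ltnS.
  have := termge _ _ gk hk; rewrite ki /= => /(_ isT).
  rewrite subnKC // -!termw // subnKC // -/T.
  case=> [|[_]]; last by rewrite ltxx.
  by rewrite ltrD2r ltz_nat ltn_mul2l A0.
have Tdvd : ~~ ((p ^ (vz p T).+1)%N%:Z %| T)%Z by rewrite dvdz_pfactor // ltnn.
have S0 : (g * h)`_(i + j) != 0.
  apply: contra Tdvd => /eqP S0; rewrite S0 in eqR.
  have := Rdvd; have -> : R = - T by apply/eqP; rewrite -addr_eq0 addrC -eqR.
  by rewrite !dvdzE abszN.
have vS : vz p (g * h)`_(i + j) = vz p T.
  apply/eqP; rewrite eqn_leq; apply/andP; split.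
    rewrite leqNgt -dvdz_pfactor // eqR; apply: contra Tdvd => Sdvd.
    by have := rpredB Sdvd Rdvd; rewrite addrK.
  rewrite -dvdz_pfactor // eqR; apply: rpredD; first by rewrite dvdz_pfactor.
  apply: dvdz_trans Rdvd; rewrite dvdzE /=; exact: dvdn_exp2l.
have wS : w (g * h) (i + j)%N = w g i + w h j.
  by rewrite -termw // /w /newton_weight vS.
split=> //; split=> // l Sl lij; rewrite -/w wS.
have [k [kl gk hk le_w]] := coefge _ Sl.
have ne : (k != i) || ((l - k)%N != j).
  by rewrite -negb_and; apply: contra lij => /andP[/eqP <- /eqP <-]; rewrite subnKC.
have := termge _ _ gk hk ne; rewrite subnKC //.
case=> [lt_w|[-> lt_e]]; first by left; apply: lt_le_trans le_w.
by move: le_w; rewrite le_eqVlt => /predU1P[->|]; [right|left].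
Qed.

Lemma newton_vertex_weight p A B s t g i j :
  newton_vertex p A B s g i -> newton_vertex p A B t g j ->
  newton_weight p A B g i = newton_weight p A B g j.
Proof.
move=> [gi imin] [gj jmin]; have [->//|ij] := eqVneq i j.
have ji : j != i by rewrite eq_sym.
apply/eqP; rewrite eq_le; apply/andP; split.
  by case: (imin _ gj ji) => [/ltW|[->]].
by case: (jmin _ gi ij) => [/ltW|[->]].
Qed.

(** The face of [g * h] runs from 0 to [r]. Left endpoints of the factors add up to 0, so that of
    [g] is 0; the right endpoints [d] and [e] add up to [r]. *)
Lemma newton_edgeM p A B (g h : {poly int}) r : prime p -> (0 < A)%N ->
    let w := newton_weight p A B in
    (g * h)`_0 != 0 -> (g * h)`_r != 0 -> w (g * h) 0%N = w (g * h) r ->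
    (forall j, (g * h)`_j != 0 -> w (g * h) 0%N <= w (g * h) j) ->
    (forall j, (g * h)`_j != 0 -> (r < j)%N -> w (g * h) 0%N < w (g * h) j) ->
  exists d e, [/\ (d + e = r)%N, (d < size g)%N, (e < size h)%N
    & w g 0%N = w g d].
Proof.
move=> pp A0 w f0 fr eqw wmin wout.
have v0 : newton_vertex p A B 1 (g * h) 0.
  split=> // j fj j0; have := wmin j fj; rewrite le_eqVlt !mul1r ltz_nat lt0n j0.
  by case/predU1P => [|]; [right|left].
have vr : newton_vertex p A B (-1) (g * h) r.
  split=> // j fj jr; rewrite -[newton_weight _ _ _ _ r]eqw !mulN1r ltrN2 ltz_nat.
  have := wmin j fj; rewrite le_eqVlt; case/predU1P => [eq0j|]; last by left.
  right; split=> //; case: ltngtP jr => // /(wout _ fj).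
  by rewrite eq0j ltxx.
have /norP[g0 h0] : ~~ ((g == 0) || (h == 0)).
  by rewrite -mulf_eq0; apply: contra f0 => /eqP ->; rewrite coef0.
have [i gi] := @newton_vertex_ex p A B 1 g isT g0.
have [j hj] := @newton_vertex_ex p A B 1 h isT h0.
have [d gd] := @newton_vertex_ex p A B (-1) g isT g0.
have [e he] := @newton_vertex_ex p A B (-1) h isT h0.
have /esym/eqP := newton_vertex_uniq v0 (newton_vertexM pp A0 gi hj).1.
rewrite addn_eq0 => /andP[/eqP i0 _]; rewrite i0 in gi.
have nzlt (u : {poly int}) k : u`_k != 0 -> (k < size u)%N.
  by rewrite ltnNge; apply: contra => /leq_sizeP ->.
exists d, e; split.
- exact/esym/(newton_vertex_uniq vr (newton_vertexM pp A0 gd he).1).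
- exact/nzlt/gd.1.
- exact/nzlt/he.1.
- exact: newton_vertex_weight gi gd.
Qed.

(** * Quotients of valuations turned into inequalities in [nat] *)

Lemma nu_div_lt p (x y : int) (a b : nat) : (0 < a)%N -> (0 < b)%N ->
    x != 0 -> y != 0 ->
  (nu p x / a%:R%:E < nu p y / b%:R%:E)%E = (vz p x * b < vz p y * a)%N.
Proof.
move=> a0 b0 x0 y0; rewrite /nu (negbTE x0) (negbTE y0) !inver.
rewrite !pnatr_eq0 !eqn0Ngt a0 b0 /= -!EFinM lte_fin.
by rewrite ltr_pdivrMr ?ltr0n // mulrAC ltr_pdivlMr ?ltr0n // -!natrM ltr_nat.
Qed.

Lemma nu_div_le p (x y : int) (a b : nat) : (0 < a)%N -> (0 < b)%N ->
    x != 0 -> y != 0 ->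
  (nu p x / a%:R%:E <= nu p y / b%:R%:E)%E = (vz p x * b <= vz p y * a)%N.
Proof.
move=> a0 b0 x0 y0; rewrite /nu (negbTE x0) (negbTE y0) !inver.
rewrite !pnatr_eq0 !eqn0Ngt a0 b0 /= -!EFinM lee_fin.
by rewrite ler_pdivrMr ?ltr0n // mulrAC ler_pdivlMr ?ltr0n // -!natrM ler_nat.
Qed.

Lemma nu_eq0 p (x : int) : nu p x = 0%E -> x != 0 /\ vz p x = 0%N.
Proof.
rewrite /nu; case: eqVneq => // _ [] /eqP.
by rewrite pnatr_eq0 => /eqP.
Qed.

Lemma nu_gt0 p (x : int) : x != 0 -> (0 < nu p x)%E = (0 < vz p x)%N.
Proof. by move=> x0; rewrite /nu (negbTE x0) lte_fin ltr0n. Qed.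

Theorem theorem1p9 (n : nat) (a : nat -> int) (p q : nat)
  (ha : a 0%N * a n != 0)
  (hp : prime p) (hq : prime q) (hpq : p != q)
  (hi_0 : (0 < nu p (a 0%N))%E)
  (hi_mid : forall i : nat, (0 < i < n - 1)%N ->
     (nu p (a 0%N) / (n - 1)%:R%:E < nu p (a i) / (n - 1 - i)%:R%:E)%E)
  (hi_last : nu p (a (n - 1)%N) = 0%E)
  (hii_0 : nu q (a 0%N) = 0%E)
  (hii_mid : forall i : nat, (1 <= i <= n)%N ->
     (nu q (a n) / n%:R%:E <= nu q (a i) / i%:R%:E)%E)
  (hii_n : ~~ (n %| logn q `|a n|%N)%N)
  (hiii : gcdn (logn p `|a 0%N|%N) (n - 1) = 1%N) :
  irreducible_poly
    (map_poly intr (\poly_(i < n.+1) a i) : {poly rat}).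
Proof.
have /andP[a0 an] : (a 0%N != 0) && (a n != 0) by rewrite -negb_or -mulf_eq0.
have [an1 van1] := nu_eq0 hi_last.
have [_ va0] := nu_eq0 hii_0.
move: hi_0; rewrite nu_gt0 // => va0_gt0.
(* For [n <= 1] truncated subtraction gives [n - 1 = 0], and [hi_last] contradicts [hi_0]. *)
have n_gt1 : (1 < n)%N.
  rewrite ltnNge -subn_eq0; apply/negP => /eqP n1.
  by move: van1 va0_gt0; rewrite n1 => ->.
pose f := \poly_(i < n.+1) a i.
have fE i : f`_i = if (i <= n)%N then a i else 0 by rewrite coef_poly ltnS.
have sf : size f = n.+1 by rewrite size_poly_eq.
have f0 : f`_0 = a 0%N by rewrite fE.
have fn : f`_n = a n by rewrite fE leqnn.
have fn1 : f`_(n - 1)%N = a (n - 1)%N by rewrite fE leq_subr.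
have fnz i : f`_i != 0 -> (i <= n)%N /\ f`_i = a i.
  by rewrite fE; case: leqP => // _; rewrite eqxx.
have size_factors (g h : {poly int}) : f = g * h ->
    [/\ size g + size h = n.+2, 0 < size g & 0 < size h]%N.
  move=> fgh; have : g * h != 0 by rewrite -fgh -size_poly_gt0 sf.
  rewrite mulf_eq0 => /norP[g0 h0].
  rewrite !size_poly_gt0; split=> //; have := sf; rewrite fgh size_mul //.
  by case: (_ + _)%N => //= m ->.
have no_linear (g h : {poly int}) : f = g * h -> size g <> 2%N.
  move=> fgh sg; have shn : size h = n by have [] := size_factors g h fgh; lia.
  have [] := @newton_edgeM q n (- (vz q (a n))%:Z) g h n hq (ltnW n_gt1).
  - by rewrite -fgh f0.
  - by rewrite -fgh fn.
  - by rewrite -fgh /newton_weight f0 fn va0; lia.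
  - move=> j; rewrite -fgh => fj; have [jn fjE] := fnz _ fj.
    rewrite /newton_weight f0 va0 fjE; case: (posnP j) => [->|j0].
      by lia.
    have := hii_mid j; rewrite j0 jn nu_div_le -?fjE // ?(ltnW n_gt1) // => /(_ isT).
    by nia.
  - by move=> j; rewrite -fgh => /fnz[]; rewrite leqNgt => /negbTE ->.
  (* Equal weights at 0 and 1 read [vz q (a n) = n * (vz q g_1 - vz q g_0)], against [hii_n]. *)
  move=> d [e [de]]; rewrite sg shn => d2 en; have -> : d = 1%N by lia.
  rewrite /newton_weight => eqw; case/negP: hii_n.
  by apply/dvdnP; exists (vz q (g`_1)%R - vz q (g`_0)%R)%N; nia.
have big_factor (g h : {poly int}) : f = g * h -> (size g <= 2)%N || (size h <= 2)%N.
  move=> fgh; have [sgh _ _] := size_factors g h fgh.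
  have n1_gt0 : (0 < n - 1)%N by rewrite subn_gt0.
  have [] := @newton_edgeM p (n - 1) (vz p (a 0%N))%:Z g h (n - 1) hp n1_gt0.
  - by rewrite -fgh f0.
  - by rewrite -fgh fn1.
  - by rewrite -fgh /newton_weight f0 fn1 van1; lia.
  - move=> j; rewrite -fgh => fj; have [jn fjE] := fnz _ fj.
    rewrite /newton_weight f0 fjE; case: (posnP j) => [->|j0].
      by lia.
    have [j1|j1] := ltnP j (n - 1); last by nia.
    have := hi_mid j; rewrite j0 j1 nu_div_lt -?fjE ?subn_gt0 // => /(_ isT).
    by nia.
  - move=> j; rewrite -fgh => fj lt_j; have [jn fjE] := fnz _ fj.
    by rewrite /newton_weight f0 fjE; nia.
  move=> d [e [de dg eh]]; rewrite /newton_weight => eqw.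
  (* Equal weights make [n - 1] divide [vz p (a 0) * d]. Hence [d] is 0 or [n - 1], and one factor
     has degree at least [n - 1]. *)
  have dvd_d : (n - 1 %| d)%N.
    rewrite -(@Gauss_dvdr _ (vz p (a 0%N))); last by rewrite coprime_sym; apply/eqP.
    by apply/dvdnP; exists (vz p (g`_0)%R - vz p (g`_d)%R)%N; nia.
  case: (posnP d) => [d0|d_gt0]; first by lia.
  by have := dvdn_leq d_gt0 dvd_d; lia.
have size_intr (u : {poly int}) : size (map_poly intr u : {poly rat}) = size u.
  by apply: size_map_inj_poly; [exact: intr_inj | rewrite mulr0z].
rewrite -/f; split=> [|G sG]; first by rewrite size_intr sf ltnS ltnW.
(* Gauss's lemma: up to a rational scalar, a divisor over the rationals comes from a factorization
   over the integers. *)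
case/dvdpP_rat_int => g [c c0 GE] [h fgh].
have sg : size G = size g.
  by rewrite GE size_scale // size_intr.
have sg1 : size g != 1%N by rewrite -sg.
have sh1 : size h = 1%N.
  have := big_factor g h fgh; have [] := size_factors g h fgh.
  have := no_linear g h fgh; have := no_linear h g; rewrite (mulrC h) => /(_ fgh).
  by lia.
have [k k0 hE] := size_poly1P h (introT eqP sh1).
rewrite GE fgh hE rmorphM /= map_polyC /= mulrC mul_polyC.
apply: eqp_trans (eqp_scale _ c0) _.
by rewrite eqp_sym eqp_scale // intr_eq0.
Qed.
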